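(* Let $L$ be a compact topological orthoalgebra which is Boolean. Then $L$ is a topological lattice (i.e., the meet and join operations $\wedge,\vee : L\times L\to L$ are continuous), and hence $L$ is a compact topological Boolean algebra.
   Context: An orthoalgebra is a structure $(L,\oplus,0,1)$ consisting of a set $L$, a partially-defined binary operation $\oplus$ on $L$, and two distinguished elements $0,1\in L$. The operation is commutative (if $a\oplus b$ is defined then so is $b\oplus a$ and they are equal) and associative in the strong sense (writing $a\perp b$ when $a\oplus b$ is defined: if $a\perp b$ and $(a\oplus b)\perp c$, then $b\perp c$, $a\perp (b\oplus c)$ and $(a\oplus b)\oplus c=a\oplus(b\oplus c)$). Moreover, for all $a\in L$: (a) $a\oplus 0=0\oplus a=a$; (b) there is a unique $a'\in L$ with $a\oplus a'=1$; (c) $a\oplus a$ exists only if $a=0$. An orthoalgebra is partially ordered by $a\le b$ iff there is $c\in L$ with $b=a\oplus c$, and $'$ is an orthocomplementation for this order. The orthoalgebra is Boolean if the orthoposet $(L,\le,{}',0,1)$ is a Boolean lattice. A topological orthoalgebra is an orthoalgebra equipped with a topology such that the relation $\perp\subseteq L\times L$ is closed and the mappings $\oplus:\perp\to L$ and ${}':L\to L$ are continuous. *)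

(* Defs.v *)
From HB Require Import structures.
From mathcomp Require Import all_boot.
From mathcomp Require Import boolp classical_sets topology.

Set Implicit Arguments.
Unset Strict Implicit.
Unset Printing Implicit Defensive.

Local Open Scope classical_set_scope.

(* The partial operation is a total function [oplus] together with its domain
   of definition [perp]; no axiom constrains [oplus a b] unless [perp a b]. *)
HB.mixin Record isOrthoalgebra L := {
  perp : L -> L -> Prop;
  oplus : L -> L -> L;
  ozero : L;
  oone : L;
  ocompl : L -> L;
  oplusC : forall a b, perp a b -> perp b a /\ oplus a b = oplus b a;
  oplusA : forall a b c, perp a b -> perp (oplus a b) c ->
    [/\ perp b c, perp a (oplus b c) &
        oplus (oplus a b) c = oplus a (oplus b c)];
  oplus0 : forall a, perp a ozero /\ oplus a ozero = a;
  o0plus : forall a, perp ozero a /\ oplus ozero a = a;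
  ocomplP : forall a,
    unique (fun b => perp a b /\ oplus a b = oone) (ocompl a);
  perp_diag : forall a, perp a a -> a = ozero
}.

#[short(type="orthoalgebraType")]
HB.structure Definition Orthoalgebra := { L of isOrthoalgebra L }.

Arguments ozero {s}.
Arguments oone {s}.

Definition oa_le (L : orthoalgebraType) (a b : L) : Prop :=
  exists c : L, perp a c /\ b = oplus a c.

(* [within] restricts the neighbourhood filters to the domain, so the continuity
   of [oplus] is that of its restriction to the subspace [perp] of [L * L]. *)
HB.mixin Record isTopologicalOrthoalgebra L
    of Topological L & Orthoalgebra L := {
  perp_closed : closed [set p : L * L | perp p.1 p.2];
  oplus_continuous : {within [set p : L * L | perp p.1 p.2],
    continuous (fun p : L * L => oplus p.1 p.2)};
  ocompl_continuous : continuous (ocompl : L -> L)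
}.

#[short(type="topologicalOrthoalgebraType")]
HB.structure Definition TopologicalOrthoalgebra :=
  { L of Topological L & Orthoalgebra L & isTopologicalOrthoalgebra L }.

(* Lattices are taken relative to an explicit order relation: the order at hand
   is derived from [oplus], and the order structures of MathComp that extend
   lattices cannot be joined with [topologicalType], because only the totally
   ordered case is present in the hierarchy of topological structures. *)
Record is_lattice (T : Type) (le : T -> T -> Prop) (meet join : T -> T -> T) :
    Prop := {
  lat_refl : forall a, le a a;
  lat_anti : forall a b, le a b -> le b a -> a = b;
  lat_trans : forall a b c, le a b -> le b c -> le a c;
  lat_meetP : forall a b c, le c (meet a b) <-> le c a /\ le c b;
  lat_joinP : forall a b c, le (join a b) c <-> le a c /\ le b c
}.

Record is_boolean_lattice (T : Type) (le : T -> T -> Prop) (compl : T -> T)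
    (bot top : T) (meet join : T -> T -> T) : Prop := {
  bool_lattice :> is_lattice le meet join;
  bool_meetDjoin : forall a b c,
    meet a (join b c) = join (meet a b) (meet a c);
  bool_bot : forall a, le bot a;
  bool_top : forall a, le a top;
  bool_meet_compl : forall a, meet a (compl a) = bot;
  bool_join_compl : forall a, join a (compl a) = top
}.

(* The operations [meet] and [join] are determined by the order, so naming them
   is only a way to refer to them. *)
Definition is_boolean_orthoalgebra (L : orthoalgebraType)
    (meet join : L -> L -> L) : Prop :=
  is_boolean_lattice (@oa_le L) ocompl ozero oone meet join.

Definition topological_lattice (T : topologicalType) (le : T -> T -> Prop)
    (meet join : T -> T -> T) : Prop :=
  [/\ is_lattice le meet join,
      continuous (fun p : T * T => meet p.1 p.2) &
      continuous (fun p : T * T => join p.1 p.2)].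

Definition topological_boolean_algebra (T : topologicalType)
    (le : T -> T -> Prop) (compl : T -> T) (bot top : T)
    (meet join : T -> T -> T) : Prop :=
  [/\ is_boolean_lattice le compl bot top meet join,
      topological_lattice le meet join &
      continuous compl].

(* Main.v *)
(* In a Boolean orthoalgebra, y = (x /\ y) (+) r with r orthogonal to x, and
   x /\ y is the only m <= x for which such an r exists.  These conditions on
   (x, y, m, r) are closed, so along any ultrafilter converging to (x, y) the
   limits of x /\ y and r, which exist by compactness, again satisfy them. *)
Require Import Defs.
From mathcomp Require Import all_boot.
From mathcomp Require Import boolp classical_sets topology.

Set Implicit Arguments.
Unset Strict Implicit.
Unset Printing Implicit Defensive.

Section UltrafilterConvergence.
Local Open Scope classical_set_scope.

(** Compactness provides a cluster point [l]. If the preimage of a neighbourhood of [l] were not in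
    [U], its complement would be, and [l] could not be a cluster point. *)
Lemma compact_ultra_cvg (I : Type) (T : topologicalType) (f : I -> T)
    (U : set_system I) :
  compact [set: T] -> UltraFilter U -> exists l : T, f @ U --> l.
Proof.
move=> Tcompact UU.
have UP : ProperFilter U by exact: ultra_proper.
have [l [_ fUl]] := Tcompact (f @ U) _ filterT.
exists l => A lA.
have [//|UnfA] := in_ultra_setVsetC (f @^-1` A) UU.
by have [z []] := fUl (~` A) A UnfA lA.
Qed.

Lemma ultra_cvg (I : Type) (T : topologicalType) (f : I -> T)
    (F : set_system I) (l : T) : Filter F ->
  (forall U : set_system I, UltraFilter U -> F `<=` U -> f @ U --> l) ->
  f @ F --> l.
Proof.
move=> FF ultral A lA; apply: contrapT => FnA.
(* If the preimage of [A] is not in [F], then [F] restricted to its complement is still proper. An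
   ultrafilter refining it would contain both sets. *)
have GP : ProperFilter (within (~` (f @^-1` A)) F).
  apply: Build_ProperFilter_ex => B FB; apply: contrapT => B0; apply: FnA.
  apply: (filterS (F := F)) FB => x nAB; apply: contrapT => nAx.
  by apply: B0; exists x; apply: nAB.
have [U [UU sGU]] := ultraFilterLemma GP.
have UP : ProperFilter U by exact: ultra_proper.
have UnA : U (~` (f @^-1` A)) by apply: sGU; apply: withinT.
have sFU : F `<=` U by move=> B FB; apply: sGU; apply: (filterS (F := F)) FB.
have UA : U (f @^-1` A) by apply: ultral sFU _ lA.
by have [x []] := filter_ex (filterI UA UnA).
Qed.

End UltrafilterConvergence.

Section Orthoalgebra.
Context {L : orthoalgebraType}.
Implicit Types a b c d : L.

Lemma perp_ocompl a : perp a (ocompl a) /\ oplus a (ocompl a) = oone.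
Proof. by have [] := ocomplP a. Qed.

Lemma ocompl_unique a b : perp a b -> oplus a b = oone -> ocompl a = b.
Proof. by have [_ u] := ocomplP a => pab eab; apply: u. Qed.

Lemma ocomplK a : ocompl (ocompl a) = a.
Proof.
have [pa ea] := perp_ocompl a; have [pa' ea'] := oplusC _ _ pa.
by apply: ocompl_unique => //; rewrite -ea'.
Qed.

Lemma perpC a b : perp a b -> perp b a.
Proof. by move=> /oplusC[]. Qed.

Lemma oa_le_oplusl a b : perp a b -> oa_le a (oplus a b).
Proof. by exists b. Qed.

Lemma oa_le_oplusr a b : perp a b -> oa_le b (oplus a b).
Proof. by move=> /oplusC[pba ->]; apply: oa_le_oplusl. Qed.

(** Cancellation: with [d] the complement of [oplus a b], reassociating [(b + a) + d = 1] shows that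
    [b] is the complement of [a + d], which depends only on [a] and the sum. *)
Lemma oplus_inj a b c : perp a b -> perp a c -> oplus a b = oplus a c -> b = c.
Proof.
move=> pab pac eabc.
suff complK b' : perp a b' -> oplus a b' = oplus a b ->
    b' = ocompl (oplus a (ocompl (oplus a b))).
  by rewrite (complK b) // (complK c).
move=> pab' e; have [pd ed] := perp_ocompl (oplus a b).
have [pb'a eb'a] := oplusC _ _ pab'.
rewrite -{1}e eb'a in pd; rewrite -{1}e eb'a in ed.
have [_ pb'ad eb'ad] := oplusA _ _ _ pb'a pd.
have [padb' eadb'] := oplusC _ _ pb'ad.
by apply/esym/ocompl_unique => //; rewrite -eadb' -eb'ad.
Qed.

(** This removes the existential from the order, so that topological facts about [perp] transfer to
    it. For the converse, the witness is the complement of [a + b']. *)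
Lemma oa_le_perp a b : oa_le a b <-> perp a (ocompl b).
Proof.
split=> [[c [pac eb]]|pab'].
  have [pbb' _] := perp_ocompl b; have [pca eac] := oplusC _ _ pac.
  rewrite {1}eb eac in pbb'.
  by have [] := oplusA _ _ _ pca pbb'.
have [pd ed] := perp_ocompl (oplus a (ocompl b)).
set d := ocompl (oplus _ _) in pd ed.
have [pb'a eb'a] := oplusC _ _ pab'.
rewrite eb'a in pd ed.
have [pad pb'ad eb'ad] := oplusA _ _ _ pb'a pd.
exists d; split=> //; rewrite -[LHS]ocomplK.
by apply: ocompl_unique => //; rewrite -eb'ad.
Qed.

Lemma oa_le_ocompl a b : oa_le a b -> oa_le (ocompl b) (ocompl a).
Proof. by rewrite !oa_le_perp ocomplK => /perpC. Qed.

End Orthoalgebra.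

Section BooleanOrthoalgebra.
Context {L : orthoalgebraType} {meet join : L -> L -> L}.
Hypothesis Lboolean : is_boolean_orthoalgebra meet join.
Implicit Types a b m r x y : L.

Lemma boolean_oa_le0 a : oa_le a ozero -> a = ozero.
Proof. by move=> a0; apply: (lat_anti Lboolean) => //; apply: (bool_bot Lboolean). Qed.

(** Orthogonality gives [a <= b'], so [m] lies below the meet of [b] and [b']. *)
Lemma boolean_disjoint a b m : oa_le m a -> oa_le m b -> perp a b -> m = ozero.
Proof.
move=> ma mb; rewrite -[b in perp _ b]ocomplK -oa_le_perp => ab'.
apply: boolean_oa_le0; rewrite -(bool_meet_compl Lboolean b).
by apply/(lat_meetP Lboolean); split=> //; apply: (lat_trans Lboolean) ab'.
Qed.

Lemma boolean_oplus_meet x y :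
  exists r, [/\ perp (meet x y) r, y = oplus (meet x y) r & perp x r].
Proof.
have [mx my] : oa_le (meet x y) x /\ oa_le (meet x y) y.
  by apply/(lat_meetP Lboolean)/(lat_refl Lboolean).
have [r [pmr ey]] := my.
exists r; split=> //; apply: perpC.
have [rr_ rr] : oa_le (meet r x) r /\ oa_le (meet r x) x.
  by apply/(lat_meetP Lboolean)/(lat_refl Lboolean).
(* The meet of [r] and [x] lies below [r] and, since [r <= y], also below [meet x y]; these two are
   orthogonal. *)
have rx0 : meet r x = ozero.
  apply: (boolean_disjoint (a := meet x y) (b := r)) => //.
  apply/(lat_meetP Lboolean); split=> //.
  by apply: (lat_trans Lboolean) rr_ _; rewrite ey; apply: oa_le_oplusr.
(* Distributivity now gives [r <= x'], that is, [r] is orthogonal to [x]. *)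
have rE : meet r (join x (ocompl x)) = meet r (ocompl x).
  rewrite (bool_meetDjoin Lboolean) rx0.
  apply: (lat_anti Lboolean).
    apply/(lat_joinP Lboolean).
    by split; [apply: (bool_bot Lboolean)|apply: (lat_refl Lboolean)].
  by have /(lat_joinP Lboolean)[] := lat_refl Lboolean (join ozero (meet r (ocompl x))).
have /(lat_meetP Lboolean)[_] : oa_le r (meet r (ocompl x)).
  rewrite -rE (bool_join_compl Lboolean).
  apply/(lat_meetP Lboolean).
  by split; [apply: (lat_refl Lboolean)|apply: (bool_top Lboolean)].
by rewrite oa_le_perp ocomplK.
Qed.

(** Write [meet x y = m + t] and [y = (m + t) + s]. Cancelling [m] gives [r = t + s], so [t] lies
    below both [x] and [r], which are orthogonal, and [t = 0]. *)
Lemma boolean_meet_unique x y m r :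
  oa_le m x -> perp m r -> y = oplus m r -> perp x r -> m = meet x y.
Proof.
move=> mx pmr ey pxr.
have [cx [s [pcs ey']]] : oa_le (meet x y) x /\ oa_le (meet x y) y.
  by apply/(lat_meetP Lboolean)/(lat_refl Lboolean).
have [t [pmt ec]] : oa_le m (meet x y).
  by apply/(lat_meetP Lboolean); split=> //; rewrite ey; apply: oa_le_oplusl.
rewrite ec in cx pcs ey' *.
have [pts pmts emts] := oplusA _ _ _ pmt pcs.
have ->: t = ozero.
  apply: boolean_disjoint pxr.
    by apply: (lat_trans Lboolean) cx; apply: oa_le_oplusr.
  have -> : r = oplus t s by apply: oplus_inj pmr pmts _; rewrite -ey -emts.
  exact: oa_le_oplusl.
by have [_ ->] := oplus0 m.
Qed.

(** De Morgan's law, from the order-reversing involution; it reduces continuity of the join to that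
    of the meet. *)
Lemma boolean_joinE a b : join a b = ocompl (meet (ocompl a) (ocompl b)).
Proof.
have [aj bj] : oa_le a (join a b) /\ oa_le b (join a b).
  by apply/(lat_joinP Lboolean)/(lat_refl Lboolean).
have [ma mb] : oa_le (meet (ocompl a) (ocompl b)) (ocompl a) /\
    oa_le (meet (ocompl a) (ocompl b)) (ocompl b).
  by apply/(lat_meetP Lboolean)/(lat_refl Lboolean).
apply: (lat_anti Lboolean).
  apply/(lat_joinP Lboolean).
  by split; [rewrite -[a]ocomplK|rewrite -[b]ocomplK]; apply: oa_le_ocompl;
    rewrite !ocomplK.
rewrite -[join a b]ocomplK; apply: oa_le_ocompl.
by apply/(lat_meetP Lboolean); split; apply: oa_le_ocompl.
Qed.

End BooleanOrthoalgebra.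

Section TopologicalOrthoalgebra.
Local Open Scope classical_set_scope.
Context {L : topologicalOrthoalgebraType}.
Context {I : Type} {F : set_system I} {FF : ProperFilter F}.
Implicit Types (f g : I -> L) (a b : L).

Lemma perp_cvg f g a b : f @ F --> a -> g @ F --> b ->
  (\forall i \near F, perp (f i) (g i)) -> perp a b.
Proof.
move=> fa gb pfg.
exact: (closed_cvg _ (@perp_closed L) pfg (a, b) (cvg_pair fa gb)).
Qed.

Lemma oa_le_cvg f g a b : f @ F --> a -> g @ F --> b ->
  (\forall i \near F, oa_le (f i) (g i)) -> oa_le a b.
Proof.
move=> fa gb lefg; apply/oa_le_perp; apply: (perp_cvg (g := ocompl \o g)) fa _ _.
  exact: cvg_comp gb (ocompl_continuous b).
by apply: filterS lefg => i /oa_le_perp.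
Qed.

Lemma oplus_cvg f g a b : f @ F --> a -> g @ F --> b ->
  (\forall i \near F, perp (f i) (g i)) ->
  (fun i => oplus (f i) (g i)) @ F --> oplus a b.
Proof.
move=> fa gb pfg; have pab := perp_cvg fa gb pfg.
(* Continuity holds only relative to [perp]: closedness puts the limit pair in the domain, and [pfg]
   keeps the approximating pairs there. *)
have /subspace_continuousP/(_ (a, b) pab) cont := @oplus_continuous L.
apply: (cvg_comp (fun i => (f i, g i)) (fun p => oplus p.1 p.2) _ cont) => A /= abA.
have FA : \forall i \near F, perp (f i) (g i) -> A (f i, g i).
  exact: cvg_pair fa gb _ abA.
by apply: (filterS2 (F := F)) pfg FA => i pi; apply.
Qed.

End TopologicalOrthoalgebra.

Section BooleanTopologicalOrthoalgebra.
Local Open Scope classical_set_scope.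
Context {L : topologicalOrthoalgebraType} {meet join : L -> L -> L}.
Hypothesis Lcompact : compact [set: L].
Hypothesis Lboolean : is_boolean_orthoalgebra meet join.

Lemma boolean_meet_continuous : continuous (fun p : L * L => meet p.1 p.2).
Proof.
(* The remainders are chosen as one function of the pair, so that they have a limit along an
   ultrafilter. *)
have [r rP] := choice (fun p : L * L => boolean_oplus_meet Lboolean p.1 p.2).
move=> p; apply: ultra_cvg => U UU pU.
have UP : ProperFilter U by exact: ultra_proper.
have [m mU] := compact_ultra_cvg (fun p => meet p.1 p.2) Lcompact UU.
have [k kU] := compact_ultra_cvg r Lcompact UU.
have xU : fst @ U --> p.1 by move=> A pA; apply: pU; apply: cvg_fst pA.
have yU : snd @ U --> p.2 by move=> A pA; apply: pU; apply: cvg_snd pA.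
have pmr : \forall q \near U, perp (meet q.1 q.2) (r q).
  by apply: nearW => q; have [] := rP q.
have mkU : snd @ U --> oplus m k.
  rewrite (_ : snd = fun q => oplus (meet q.1 q.2) (r q)).
    exact: oplus_cvg mU kU pmr.
  by apply/funext => q; have [] := rP q.
suff -> : meet p.1 p.2 = m by [].
apply/esym/(boolean_meet_unique Lboolean (r := k)).
- apply: oa_le_cvg mU xU _; apply: nearW => q.
  by have [] := (lat_meetP Lboolean q.1 q.2 (meet q.1 q.2)).1 (lat_refl Lboolean _).
- exact: perp_cvg mU kU pmr.
(* Both [p.2] and [oplus m k] are limits of [snd] along [U]. They agree because the order passes to
   limits and is antisymmetric. *)
- by apply: (lat_anti Lboolean);
    [apply: oa_le_cvg yU mkU _|apply: oa_le_cvg mkU yU _];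
    apply: nearW => q; apply: (lat_refl Lboolean).
- by apply: perp_cvg xU kU _; apply: nearW => q; have [] := rP q.
Qed.

Lemma boolean_join_continuous : continuous (fun p : L * L => join p.1 p.2).
Proof.
under eq_fun do rewrite (boolean_joinE Lboolean).
move=> p; pose c (q : L * L) := (ocompl q.1, ocompl q.2).
have cp : c @ p --> c p.
  by apply: cvg_pair; [apply: (cvg_comp fst ocompl)|apply: (cvg_comp snd ocompl)];
    [apply: cvg_fst|apply: ocompl_continuous|apply: cvg_snd|apply: ocompl_continuous].
have mp := cvg_comp _ _ cp (@boolean_meet_continuous (c p)).
exact: (cvg_comp _ _ mp (@ocompl_continuous L _)).
Qed.

End BooleanTopologicalOrthoalgebra.

Theorem proposition2p8 (L : topologicalOrthoalgebraType)
    (Lcompact : compact [set: L]%classic)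
    (meet join : L -> L -> L)
    (Lboolean : is_boolean_orthoalgebra meet join) :
  topological_lattice (@oa_le L) meet join /\
  (compact [set: L]%classic /\
   topological_boolean_algebra (@oa_le L) ocompl ozero oone meet join).
Proof.
have lattice : topological_lattice (@oa_le L) meet join.
  split; first exact: bool_lattice Lboolean.
    exact: boolean_meet_continuous Lcompact Lboolean.
  exact: boolean_join_continuous Lcompact Lboolean.
by split=> //; split=> //; split=> //; apply: ocompl_continuous.
Qed.
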